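(* Let $R$ be a ring with proper involution $*$, let $m\ge 1$ be an integer and let $a\in R$. Then the following are equivalent: (1) $a$ has an $m$-weak group inverse. (2) $a$ has an $m$-weak group decomposition, i.e., there exist $x,y\in R$ such that $$a=x+y,\quad x^*a^{m-1}y=yx=0,\quad x\in R^{\#},\quad y\in R^{nil}.$$ (3) $a\in R^D$ and there exists $x\in R$ such that $$x=ax^2,\quad (a^D)^*a^{m+1}x=(a^D)^*a^m,\quad a^n=xa^{n+1}\ \text{for some } n\in\mathbb{N}.$$
   Context: Rings are associative with identity and $\mathbb{N}$ is the set of positive integers; $a^0=1$. An involution $*$ on $R$ satisfies $(x+y)^*=x^*+y^*$, $(xy)^*=y^*x^*$, $(x^* )^*=x$; it is proper if $x^*x=0$ implies $x=0$. An element $a\in R$ has an $m$-weak group inverse if there exist $x\in R$ and $k\in\mathbb{N}$ with $ax^2=x$, $xa^{k+1}=a^k$ and $(a^k)^*a^{m+1}x=(a^k)^*a^m$; such an $x$ is unique if it exists. $R^{D}$ is the set of Drazin invertible elements: $a\in R^D$ if there are $x\in R$, $k\in\mathbb{N}$ with $ax^2=x$, $ax=xa$, $a^k=xa^{k+1}$; this unique $x$ is denoted $a^D$. $R^{\#}$ is the set of elements with a group inverse: there is $x\in R$ with $ax^2=x$, $ax=xa$, $a=a^2x$. $R^{nil}$ is the set of nilpotent elements of $R$. *)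

(* Defs.v *)
From mathcomp Require Import all_boot all_algebra.
From mathcomp Require Import boolp classical_sets.

Set Implicit Arguments.
Unset Strict Implicit.
Unset Printing Implicit Defensive.

Import GRing.Theory.
Local Open Scope ring_scope.

(* [pzRingType] (rather than [nzRingType]): the zero ring is allowed. *)

Definition is_involution (R : pzRingType) (star : R -> R) : Prop :=
  [/\ forall x y, star (x + y) = star x + star y,
      forall x y, star (x * y) = star y * star x
    & forall x, star (star x) = x].

Definition is_proper_involution (R : pzRingType) (star : R -> R) : Prop :=
  is_involution star /\ forall x, star x * x = 0 -> x = 0.

Definition is_weak_group_inverse (R : pzRingType) (star : R -> R) (m : nat)
    (a x : R) : Prop :=
  exists k : nat,
    [/\ (0 < k)%N, a * x ^+ 2 = x, x * a ^+ k.+1 = a ^+ k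
      & star (a ^+ k) * a ^+ m.+1 * x = star (a ^+ k) * a ^+ m].

Definition has_weak_group_inverse (R : pzRingType) (star : R -> R) (m : nat)
    (a : R) : Prop :=
  exists x : R, is_weak_group_inverse star m a x.

Definition is_drazin_inverse (R : pzRingType) (a x : R) : Prop :=
  exists k : nat,
    [/\ (0 < k)%N, a * x ^+ 2 = x, a * x = x * a & a ^+ k = x * a ^+ k.+1].

Definition drazin_invertible (R : pzRingType) (a : R) : Prop :=
  exists x : R, is_drazin_inverse a x.

(* Takes the junk value 0 when [a] is not Drazin invertible. *)
Definition drazin_inv (R : pzRingType) (a : R) : R :=
  xget 0 [set x | is_drazin_inverse a x]%classic.

Definition group_invertible (R : pzRingType) (a : R) : Prop :=
  exists x : R, [/\ a * x ^+ 2 = x, a * x = x * a & a = a ^+ 2 * x].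

Definition nilpotent_elt (R : pzRingType) (a : R) : Prop :=
  exists n : nat, (0 < n)%N /\ a ^+ n = 0.

(* For [m = 0] the truncated [m.-1] would be 0; only [m >= 1] is meaningful. *)
Definition has_weak_group_decomposition (R : pzRingType) (star : R -> R)
    (m : nat) (a : R) : Prop :=
  exists x y : R,
    [/\ a = x + y, star x * a ^+ m.-1 * y = 0, y * x = 0,
        group_invertible x & nilpotent_elt y].

Lemma is_drazin_inverse_inj (R : pzRingType) (a x y : R) :
  is_drazin_inverse a x -> is_drazin_inverse a y -> x = y.
Proof.
have pow (z : R) n : a * z ^+ 2 = z -> a * z = z * a -> a ^+ n * z ^+ n.+1 = z.
  move=> az2 azC; elim: n => [|n IHn]; first by rewrite mul1r expr1.
  rewrite exprSr -mulrA [z ^+ n.+2]exprSr exprSr -mulrA.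
  rewrite [a * (z ^+ n * _)]mulrA.
  have -> : a * z ^+ n = z ^+ n * a by apply: commrX.
  by rewrite -[z ^+ n * a * _]mulrA -expr2 az2 -exprSr.
have ind (z : R) k n : (k <= n)%N -> a ^+ k = z * a ^+ k.+1 ->
    a ^+ n = z * a ^+ n.+1.
  by move=> /subnKC <- h; rewrite exprD {1}h -mulrA -exprD addSn.
move=> [k [_ ax2 axC ak]] [l [_ ay2 ayC al]].
pose n := maxn k l.
have hx := ind _ _ _ (leq_maxl k l) ak; have hy := ind _ _ _ (leq_maxr k l) al.
rewrite -/n in hx hy.
have powC (z : R) i j : a * z = z * a -> a ^+ i * z ^+ j = z ^+ j * a ^+ i.
  by move=> azC; apply: commrX; apply/commr_sym/commrX/commr_sym.
have -> : x = y * (a * x).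
  rewrite -{1}(pow x n ax2 axC) hy -mulrA exprS -mulrA.
  by rewrite pow.
rewrite -[RHS](pow y n ay2 ayC) powC // hx.
have -> : x * a ^+ n.+1 = a ^+ n.+1 * x.
  by have := powC x n.+1 1%N axC; rewrite expr1.
by rewrite [RHS]mulrA -powC // exprS -(mulrA a) pow // ayC mulrA.
Qed.

Lemma drazin_invP (R : pzRingType) (a x : R) :
  is_drazin_inverse a x -> drazin_inv a = x.
Proof.
move=> ax; apply: (@is_drazin_inverse_inj _ a) => //.
by apply: (@xgetPex _ 0 [set x | is_drazin_inverse a x]%classic); exists x.
Qed.

(* Main.v *)
Require Import Defs.
From mathcomp Require Import all_boot all_algebra.

Set Implicit Arguments.
Unset Strict Implicit.
Unset Printing Implicit Defensive.

Import GRing.Theory.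
Local Open Scope ring_scope.

(** Let X be the m-weak group inverse of a. From [a X^2 = X] and
    [X a^(k+1) = a^k] one gets that [D = X^(k+1) a^k] is the Drazin inverse of
    a. As [a^k = D a^(k+1)] and [D = a^k D^(k+1)], [(a^k)^* v = (a^k)^* w]
    is equivalent to [D^* v = D^* w], which exchanges (1) and (3).
    For (1) => (2) take [x = a^2 X] and [y = a - a^2 X]; then X is the group
    inverse of x. Conversely the group inverse of x is the m-weak group inverse
    of a. *)

Section OuterInverse.

Variables (R : pzRingType) (a x : R) (k : nat).
Hypotheses (axx : a * x ^+ 2 = x) (xak : x * a ^+ k.+1 = a ^+ k).

Lemma mul_sqr_exprSS n : a * x ^+ n.+2 = x ^+ n.+1.
Proof. by rewrite -add2n exprD mulrA axx exprS. Qed.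

(** Each [a] cancels one [x] as long as another [x] remains to its right, hence the surplus exponent
    [i.+1]. *)
Lemma exprX_exprS n i : a ^+ n * x ^+ (n + i.+1) = x ^+ i.+1.
Proof.
elim: n => [|n IHn]; first by rewrite mul1r.
by rewrite exprSr -mulrA addSn addnS mul_sqr_exprSS -addnS.
Qed.

Lemma mul_exprS n : x * a ^+ (k + n).+1 = a ^+ (k + n).
Proof. by rewrite -addSn !exprD mulrA xak. Qed.

Lemma exprX_exprD n : x ^+ n * a ^+ (k + n) = a ^+ k.
Proof.
by elim: n => [|n IHn]; rewrite ?mul1r ?addn0 // exprSr -mulrA addnS mul_exprS.
Qed.

(** [x * a] fixes every right multiple of [a ^+ k.+1], and [a * x] is one. *)
Lemma mul_sqr_mul : x * (a ^+ 2 * x) = a * x.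
Proof.
have ax : a * x = a ^+ k.+1 * x ^+ k.+1.
  by rewrite exprS -mulrA -(addn1 k) exprX_exprS expr1.
have xa : x * a ^+ k.+2 = a ^+ k.+1 by have := mul_exprS 1; rewrite addn1.
by rewrite expr2 -mulrA ax (mulrA a) -exprS mulrA xa.
Qed.

Lemma mul_mul_self : x * a * x = x.
Proof.
have ax : x = a ^+ k * x ^+ k.+1 by rewrite -addn1 exprX_exprS expr1.
by rewrite {2}ax mulrA -(mulrA x) -exprS xak.
Qed.

Lemma drazin_inverse_of_outer :
  (0 < k)%N -> is_drazin_inverse a (x ^+ k.+1 * a ^+ k).
Proof.
move=> k_gt0; exists k.
(* Positivity of [k] keeps a factor [x] after the cancellation. *)
have az : a * (x ^+ k.+1 * a ^+ k) = x ^+ k * a ^+ k.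
  by rewrite mulrA; case: (k) k_gt0 => // j _; rewrite mul_sqr_exprSS.
split=> //.
- have akx : a ^+ k * x ^+ k.+1 = x by rewrite -addn1 exprX_exprS.
  by rewrite expr2 mulrA az -mulrA (mulrA (a ^+ k)) akx mulrA -exprSr.
- by rewrite az -mulrA -exprSr exprSr -mulrA xak.
- by rewrite -mulrA -exprD exprX_exprD.
Qed.

End OuterInverse.

Section Involution.

Variables (R : pzRingType) (star : R -> R).
Hypothesis star_inv : is_involution star.

(** [star] reverses products, so [star (u * t)] has [star u] as its right factor. *)
Lemma star_mul_eq (u v w : R) :
  star u * v = star u * w -> forall t, star (u * t) * v = star (u * t) * w.
Proof. by case: star_inv => _ starM _ uvw t; rewrite starM -!mulrA uvw. Qed.

Lemma star_expr_eq_iff (a z v w : R) k :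
    a * z ^+ 2 = z -> a ^+ k = z * a ^+ k.+1 ->
  star (a ^+ k) * v = star (a ^+ k) * w <-> star z * v = star z * w.
Proof.
move=> azz ak; split=> /star_mul_eq.
  by move/(_ (z ^+ k.+1)); rewrite -addn1 exprX_exprS.
by move/(_ (a ^+ k.+1)); rewrite -ak.
Qed.

Lemma weak_group_inverse_drazinP m (a x : R) :
  is_weak_group_inverse star m a x <->
  drazin_invertible a /\
  [/\ x = a * x ^+ 2,
      star (drazin_inv a) * a ^+ m.+1 * x = star (drazin_inv a) * a ^+ m
    & exists n : nat, (0 < n)%N /\ a ^+ n = x * a ^+ n.+1].
Proof.
(* Both directions supply these hypotheses on [x], which make the Drazin inverse explicit; what
   remains is to convert the starred equation. *)
have star_swap k : (0 < k)%N -> a * x ^+ 2 = x -> x * a ^+ k.+1 = a ^+ k ->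
    drazin_invertible a /\
    (star (a ^+ k) * (a ^+ m.+1 * x) = star (a ^+ k) * a ^+ m <->
     star (drazin_inv a) * (a ^+ m.+1 * x) = star (drazin_inv a) * a ^+ m).
  move=> k0 axx xak; have D := drazin_inverse_of_outer axx xak k0.
  split; first by exists (x ^+ k.+1 * a ^+ k).
  rewrite (drazin_invP D); case: D => _ [_ azz _ _].
  apply: star_expr_eq_iff => //.
  by rewrite -mulrA -exprD (exprX_exprD xak).
split.
  case=> k [k0 axx xak]; rewrite -mulrA => h.
  have [aD swap] := star_swap k k0 axx xak.
  by split=> //; split; [|rewrite -mulrA; apply/swap|exists k].
case=> _ [/esym axx]; rewrite -mulrA => h [k [k0 /esym xak]].
have [_ swap] := star_swap k k0 axx xak.
by exists k; split=> //; rewrite -mulrA; apply/swap.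
Qed.

Lemma weak_group_inverse_decomposition m (a x : R) :
  is_weak_group_inverse star m.+1 a x ->
  has_weak_group_decomposition star m.+1 a.
Proof.
case=> k [k0 axx xak h].
have xa2x := mul_sqr_mul axx xak; have xax := mul_mul_self axx xak.
have a2xx : a ^+ 2 * x * x = a * x by rewrite expr2 -!mulrA -expr2 axx.
have yx0 : (a - a ^+ 2 * x) * (a ^+ 2 * x) = 0.
  rewrite mulrBl -(mulrA (a ^+ 2)) xa2x.
  by rewrite (mulrA a) (mulrA (a ^+ 2)) -(exprS a 2) -(exprSr a 2) subrr.
exists (a ^+ 2 * x), (a - a ^+ 2 * x); split=> //.
- by rewrite addrC subrK.
- have amy : a ^+ m * (a - a ^+ 2 * x) = a ^+ m.+1 - a ^+ m.+2 * x.
    by rewrite mulrBr mulrA -exprSr -exprD addn2.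
  (* The group invertible part is a right multiple of [a ^+ k], so the starred hypothesis transfers
     to it. *)
  have a2x : a ^+ 2 * x = a ^+ k * (a ^+ 2 * x ^+ k.+1).
    by rewrite mulrA -exprD addnC exprD -mulrA -(addn1 k) exprX_exprS.
  rewrite /= -mulrA amy mulrBr a2x.
  by rewrite (star_mul_eq (w := a ^+ m.+1)) ?subrr // mulrA.
- exists x; split.
  + by rewrite -mulrA -exprS (exprX_exprS axx 2 0).
  + by rewrite xa2x a2xx.
  + by rewrite [(_ * x) ^+ 2]expr2 -mulrA a2xx -mulrA (mulrA x) xax.
(* Since [y] kills the other summand of [a], [y ^+ k.+2] equals [y * a ^+ k.+1], which vanishes
   because [x * a ^+ k.+1 = a ^+ k]. *)
- set y := a - _ in yx0 *.
  have ya : y * a = y ^+ 2 by rewrite expr2 {3}/y mulrBr yx0 subr0.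
  have yan n : y * a ^+ n = y ^+ n.+1.
    elim: n => [|n IHn]; first by rewrite mulr1.
    by rewrite exprSr mulrA IHn exprSr -mulrA ya -exprD addn2.
  exists k.+2; split=> //.
  rewrite -yan /y mulrBl -mulrA xak.
  by rewrite -exprS -exprD subrr.
Qed.

Lemma decomposition_weak_group_inverse m (a : R) :
  has_weak_group_decomposition star m.+1 a ->
  has_weak_group_inverse star m.+1 a.
Proof.
case=> x [y [/= aE xy0 yx0 [g [xgg xgC xxg]] [n [n0 yn0]]]].
have yg0 : y * g = 0 by rewrite -xgg mulrA yx0 mul0r.
have ag : a * g = x * g by rewrite aE mulrDl yg0 addr0.
have ya i : y * a ^+ i = y ^+ i.+1.
  elim: i => [|i IHi]; first by rewrite mulr1.
  by rewrite exprS mulrA {1}aE mulrDr yx0 add0r -mulrA IHi -exprS.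
(* The remaining term [y * a ^+ i] is [y ^+ i.+1], zero from [n] on. *)
have an i : (n <= i)%N -> a ^+ i.+1 = x * a ^+ i.
  by move=> /subnK <-; rewrite exprS {1}aE mulrDl ya -addSn (exprD y)
    yn0 mulr0 addr0.
have a2g : a ^+ 2 * g = x.
  by rewrite expr2 -mulrA ag {1}aE mulrDl [y * _]mulrA yx0 mul0r addr0 mulrA.
(* With index [n.+1], [a ^+ n.+1 = x * a ^+ n] is a right multiple of [x], on which [g * x] acts as
   the identity. *)
exists g, n.+1; split=> //.
- by rewrite expr2 mulrA ag -mulrA -expr2.
- have gxx : g * (x * x) = x by rewrite mulrA -xgC -mulrA -xgC mulrA -expr2.
  by rewrite !an ?leqW // (mulrA x) mulrA gxx.
- have -> : star (a ^+ n.+1) * a ^+ m.+2 * g = star (a ^+ n.+1) * (a ^+ m * x).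
    by rewrite -mulrA -(addn2 m) exprD -mulrA a2g.
  (* It suffices to compare under [star x], where [a ^+ m * x] and [a ^+ m.+1] differ by the
     vanishing term [star x * a ^+ m * y]. *)
  rewrite an //; apply: star_mul_eq.
  by rewrite exprSr {3}aE mulrDr [RHS]mulrDr [_ * (_ * y)]mulrA xy0 addr0.
Qed.

End Involution.

Theorem theorem2p1 (R : pzRingType) (star : R -> R)
    (star_proper : is_proper_involution star)
    (m : nat) (m_ge1 : (1 <= m)%N) (a : R) :
  (has_weak_group_inverse star m a <-> has_weak_group_decomposition star m a)
  /\
  (has_weak_group_inverse star m a <->
     drazin_invertible a /\
     exists x : R,
       [/\ x = a * x ^+ 2,
           star (drazin_inv a) * a ^+ m.+1 * x = star (drazin_inv a) * a ^+ m
         & exists n : nat, (0 < n)%N /\ a ^+ n = x * a ^+ n.+1]).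
Proof.
have [star_inv _] := star_proper.
split; last first.
  split=> [[x /(weak_group_inverse_drazinP star_inv)[aD h]]|[aD [x h]]].
    by split=> //; exists x.
  by exists x; apply/weak_group_inverse_drazinP.
case: m m_ge1 => // m _; split.
  by case=> x; apply: weak_group_inverse_decomposition.
exact: decomposition_weak_group_inverse.
Qed.
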